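(* Let $p<q$ be primes. Except for $(x-1)\Phi_{pq}(x)$ and $\Phi_p(x)\Phi_q(x)$, all monic divisors in $\mathbb{Z}[x]$ of $x^{pq}-1$ are flat. The set of coefficients of $(x-1)\Phi_{pq}(x)$ is $\mathcal{C}((x-1)\Phi_{pq})=\{-2,-1,1,2\}$ if $p\le 3$ and $[-2,2]$ otherwise. The set of coefficients of $\Phi_p(x)\Phi_q(x)$ is $\mathcal{C}(\Phi_p\Phi_q)=[1,\min(p,q)]$.
   Context: $\Phi_n(x)$ denotes the $n$th cyclotomic polynomial. For a nonzero polynomial $f(x)=\sum_{j} c_jx^j\in\mathbb{Z}[x]$, $\mathcal{C}(f)=\{c_j : 0\le j\le \deg f\}$ denotes its set of coefficients. For integers $a\le b$, $[a,b]$ denotes the set of integers $\{a,a+1,\ldots,b\}$. The polynomial $f$ is called flat if $\mathcal{C}(f)\subseteq[-1,1]$. *)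

(* Defs.v *)
From mathcomp Require Import all_boot all_order all_algebra all_field.
Set Implicit Arguments.
Unset Strict Implicit.
Unset Printing Implicit Defensive.

Import Order.TTheory GRing.Theory Num.Theory.
Local Open Scope ring_scope.

(* The underlying sequence of a nonzero f is exactly [:: c_0; ...; c_(deg f)];
   it is used only up to membership, i.e. as the set {c_j : 0 <= j <= deg f}. *)
Definition coefset (f : {poly int}) : seq int := polyseq f.

Definition flat (f : {poly int}) : Prop :=
  {subset coefset f <= `[-1 : int, 1]}.

(* Divisibility in the ring Z[x]; the library's %| on {poly int} is
   pseudo-divisibility, which allows a nonzero constant multiple of g. *)
Definition divides (f g : {poly int}) : Prop := exists h : {poly int}, g = f * h.

(* Main.v *)
(* Over Z, x^(pq) - 1 = Phi_1 Phi_p Phi_q Phi_pq with prime factors, so a monic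
   divisor is one of 16 subproducts. Apart from Phi_pq, 1 and the two exceptions,
   each is g or (x^k - 1) g, where g has coefficients 0 and 1, because
   Phi_p(x) Phi_pq(x) = Phi_p(x^q), and symmetrically.
   For Phi_pq itself, let S be the numerical semigroup generated by p and q.
   As power series, Phi_pq(x) = (1 - x) \sum_(s in S) x^s, so its coefficients
   are 1_S(n) - 1_S(n-1), and those of (x - 1) Phi_pq are
   2 1_S(n-1) - 1_S(n) - 1_S(n-2). The values 2 and -2 come from 0, which is in S
   while 1 is not, and from the Frobenius number, which is not in S while both
   its neighbours are; 0 comes from 1, 2, 3 not in S when p > 3. *)
Require Import Defs.
From mathcomp Require Import all_boot all_order all_algebra all_field.
From mathcomp Require Import zify ring lra.
Import Order.TTheory GRing.Theory Num.Theory.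
Local Open Scope ring_scope.

Lemma coef_XnsubM (R : nzRingType) k (f : {poly R}) n :
  (('X^k - 1) * f)`_n = (if (n < k)%N then 0 else f`_(n - k)) - f`_n.
Proof. by rewrite mulrBl mul1r coefB coefXnM. Qed.

Lemma coefsetP (f : {poly int}) x :
  reflect (exists2 i, (i < size f)%N & f`_i = x) (x \in coefset f).
Proof. exact: nthP. Qed.

Lemma flatP (f : {poly int}) : (forall i, -1 <= f`_i <= 1) -> flat f.
Proof. by move=> f1 x /coefsetP[i _ <-]; rewrite itv_boundlr /= !bnd_simp. Qed.

Definition zero_one (f : {poly int}) := forall i, 0 <= f`_i <= 1.

Lemma zero_one_flat f : zero_one f -> flat f.
Proof. by move=> f01; apply: flatP => i; have := f01 i; lia. Qed.

Lemma flat_XnsubM k f : zero_one f -> flat (('X^k - 1) * f).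
Proof.
move=> f01; apply: flatP => i; rewrite coef_XnsubM.
by move: (f01 i) (f01 (i - k)%N); case: ifP => _; move: (f`_i) (f`_(i - k)); lia.
Qed.

Definition geom a b : {poly int} := \sum_(j < a) 'X^(j * b).

Lemma XnsubM_geom a b : ('X^b - 1) * geom a b = 'X^(a * b) - 1.
Proof.
rewrite mulnC exprM [RHS]subrX1; congr (_ * _).
by apply: eq_bigr => j _; rewrite -exprM mulnC.
Qed.

Lemma coef_geom a b n : (geom a b)`_n = \sum_(j < a) (n == j * b)%N%:R.
Proof. by rewrite coef_sum; apply: eq_bigr => j _; rewrite coefXn. Qed.

Lemma coef_geom1 a n : (geom a 1)`_n = (n < a)%N%:R.
Proof.
rewrite coef_geom; case: (ltnP n a) => [ltna|lean].
  rewrite (bigD1 (Ordinal ltna)) //= muln1 eqxx big1 ?addr0 // => j.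
  by rewrite -val_eqE /= muln1 eq_sym => /negPf->.
by rewrite big1 // => j _; rewrite muln1 gtn_eqF // (leq_trans _ lean).
Qed.

Lemma geom_zero_one a b : (0 < b)%N -> zero_one (geom a b).
Proof.
move=> b0 n; rewrite coef_geom.
case: (pickP (fun j : 'I_a => n == j * b)%N) => [j /eqP nE | n0].
  rewrite (bigD1 j) //= nE eqxx big1 // => i.
  by rewrite -val_eqE eqn_pmul2r // eq_sym => /negPf->.
by rewrite big1 // => j _; rewrite n0.
Qed.

Lemma Cyclotomic1 : 'Phi_1 = 'X - 1.
Proof. by have := @prod_Cyclotomic 1 isT; rewrite big_seq1. Qed.

Lemma Cyclotomic_prime p : prime p -> 'Phi_p = geom p 1.
Proof.
move=> pp; have := prod_Cyclotomic (prime_gt0 pp).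
have /(perm_big _)-> : perm_eq (divisors p) [:: 1; p]%N.
  apply: uniq_perm; first exact: divisors_uniq.
    by rewrite /= inE andbT neq_ltn prime_gt1.
  move=> d; rewrite -dvdn_divisors ?prime_gt0 // !inE.
  apply/idP/pred2P => [|[->|->]]; rewrite ?dvd1n //.
  by have [_ dvd_p /dvd_p/pred2P] := primeP pp.
rewrite big_cons big_seq1 Cyclotomic1 -[X in 'X^X](muln1 p) -XnsubM_geom expr1.
by apply/mulfI; rewrite -polyC1 polyXsubC_eq0.
Qed.

Lemma Cyclotomic_dvd_root {n z} {g : {poly int}} : n.-primitive_root z ->
  root (map_poly intr g : {poly algC}) z -> exists h, g = 'Phi_n * h.
Proof.
move=> zn; have [p [pz _ dvp]] := minCpolyP z.
have toQ (h : {poly int}) :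
    map_poly intr h = map_poly ratr (map_poly intr h : {poly rat}) :> {poly algC}.
  by rewrite -map_poly_comp; apply: eq_map_poly => x; rewrite /= rmorph_int.
have pE : p = map_poly intr 'Phi_n.
  apply: (map_inj_poly (fmorph_inj (@ratr algC))); first exact: rmorph0.
  by rewrite -pz -toQ (Cintr_Cyclotomic zn) (minCpoly_cyclotomic zn).
rewrite toQ dvp pE dvdp_rat_int => /dvdpP_int[h ->].
by exists h; rewrite zprimitive_monic // Cyclotomic_monic.
Qed.

Lemma Cyclotomic_prime_elt {n} {f g h : {poly int}} : (0 < n)%N ->
  f * g = 'Phi_n * h ->
  (exists k, f = 'Phi_n * k) \/ (exists k, g = 'Phi_n * k).
Proof.
move=> n0 E; have [z zn] := C_prim_root_exists n0.
have : root (map_poly intr (f * g) : {poly algC}) z.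
  by rewrite E rmorphM /= rootM (Cintr_Cyclotomic zn) root_cyclotomic // zn.
rewrite rmorphM rootM => /orP[] /(Cyclotomic_dvd_root zn); tauto.
Qed.

Lemma monic_divisor_prod_Cyclotomic s (f h : {poly int}) :
  all (leq 1) s -> f \is monic -> \prod_(d <- s) 'Phi_d = f * h ->
  exists2 m : bitseq, size m = size s & f = \prod_(d <- mask m s) 'Phi_d.
Proof.
elim: s f h => [|d s IHs] f h /=.
  rewrite big_nil => _ fmon E; exists [::] => //; rewrite big_nil.
  have : f \is a GRing.unit by apply/unitrPr; exists h.
  rewrite poly_unitE => /andP[/eqP f1 _].
  have /size1_polyC fC : (size f <= 1)%N by rewrite f1.
  by move/monicP: fmon; rewrite fC lead_coefC => ->.
move=> /andP[d0 s0] fmon; rewrite big_cons => E.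
have nzPhi := monic_neq0 (Cyclotomic_monic d).
have [] := Cyclotomic_prime_elt d0 (esym E) => -[k kE].
  have kmon : k \is monic.
    by move: fmon; rewrite kE monicMl ?Cyclotomic_monic.
  have [//||m mE mk] := IHs k h s0.
    by apply: (mulfI nzPhi); rewrite E kE mulrA.
  by exists (true :: m); rewrite /= ?mE // big_cons -mk.
have [//||m mE mf] := IHs f k s0.
  by apply: (mulfI nzPhi); rewrite E kE mulrCA.
by exists (false :: m); rewrite /= ?mE.
Qed.

(* Membership of n in the numerical semigroup generated by p and q: if
   j < p and j q = n mod p, then j q is the least element of the semigroup
   congruent to n. *)
Definition in_semigroup (p q n : nat) : bool :=
  [exists j : 'I_p, (j * q <= n)%N && (j * q == n %[mod p])].

Lemma semigroup_class {p q} n : coprime p q -> (0 < p)%N ->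
  exists2 j, (j < p)%N & j * q = n %[mod p].
Proof.
move=> co_pq p0; exists ((n * (egcdn q p).1) %% p)%N; first exact: ltn_pmod.
case: (posnP q) (co_pq) => [->|q0 _].
  by rewrite /coprime gcdn0 => /eqP->; rewrite !modn1.
case: egcdnP => //= u v E _; rewrite modnMml -mulnA E.
by rewrite (eqP (_ : coprime q p)) 1?coprime_sym // mulnDr muln1 mulnA modnMDl.
Qed.

Lemma semigroup_class_inj {p q i j} : coprime p q -> (i < p)%N -> (j < p)%N ->
  i * q = j * q %[mod p] -> i = j.
Proof.
move=> co_pq ip jp /eqP; wlog le_ij : i j ip jp / (i <= j)%N => [IH E|].
  by have [/IH->//|/ltnW/IH->//] := leqP i j; rewrite eq_sym.
rewrite eq_sym eqn_mod_dvd ?leq_mul2r ?le_ij ?orbT // -mulnBl Gauss_dvdl //.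
by case: (posnP (j - i)) => [|ji0 /(dvdn_leq ji0)]; lia.
Qed.

Lemma in_semigroupE {p q n j} : coprime p q -> (j < p)%N ->
  j * q = n %[mod p] -> in_semigroup p q n = (j * q <= n)%N.
Proof.
move=> co_pq jp jn; apply/existsP/idP => [[i /andP[le_n /eqP E]]|le_n].
  by rewrite (semigroup_class_inj co_pq jp (ltn_ord i)) // jn E.
by exists (Ordinal jp); rewrite le_n jn /=.
Qed.

Definition shift_semigroup p q k n : int :=
  ((k <= n)%N && in_semigroup p q (n - k))%:R.

Lemma coef_geom_semigroup p q n : coprime p q -> (0 < p)%N ->
  (geom p q)`_n = shift_semigroup p q 0 n - shift_semigroup p q p n.
Proof.
move=> co_pq p0; have [j jp jn] := semigroup_class n co_pq p0.
rewrite /shift_semigroup leq0n subn0 /= (in_semigroupE co_pq jp jn) //.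
have -> : (p <= n)%N && in_semigroup p q (n - p) = (j * q + p <= n)%N.
  have [le_pn|lt_np] := leqP p n; last by rewrite leqNgt ltn_addl.
  have jnp : j * q = n - p %[mod p] by rewrite jn -[in LHS](subnK le_pn) modnDr.
  by rewrite (in_semigroupE co_pq jp jnp) leq_subRL // addnC.
rewrite coef_geom (bigD1 (Ordinal jp)) //= big1 ?addr0 => [|i].
  case: ltngtP => [lt_n|gt_n|->].
  - case: leqP => le_n; first by rewrite subrr.
    move/eqP: jn; rewrite eq_sym eqn_mod_dvd ?(ltnW lt_n) // => /dvdn_leq.
    by rewrite subn_gt0 lt_n; lia.
  - by rewrite leqNgt ltn_addr // subr0.
  by rewrite leqNgt -{1}[n]addn0 ltn_add2l p0 subr0.
rewrite -val_eqE /= => ne_ij; case: eqP => // nE; case/eqP: ne_ij.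
by apply: (semigroup_class_inj co_pq) => //; rewrite -nE jn.
Qed.

Lemma coef_Cyclotomic_pq_semigroup p q (f : {poly int}) n :
  coprime p q -> (0 < p)%N -> f * ('X^p - 1) = ('X - 1) * geom p q ->
  f`_n = shift_semigroup p q 0 n - shift_semigroup p q 1 n.
Proof.
move=> co_pq p0 fE; elim/ltn_ind: n => n IHn.
have := congr1 (fun g : {poly int} => g`_n) fE.
rewrite [f * _]mulrC -['X]expr1 !coef_XnsubM.
rewrite !coef_geom_semigroup // /shift_semigroup.
case: (ltnP n 1) => [|n0].
  by case: n {IHn} => // _; rewrite p0 /= leqNgt p0 /= !sub0r => /oppr_inj.
rewrite subn0 leq0n; have [lt_np|le_pn] := ltnP n p.
  have -> /= : (p <= n - 1)%N = false by lia.
  by move=> *; lra.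
rewrite (IHn (n - p)%N) /shift_semigroup; last by lia.
have -> : (n - p - 1 = n - 1 - p)%N by lia.
have -> : (1 <= n - p)%N = (p <= n - 1)%N by lia.
by rewrite !leq0n !subn0 /= => *; lra.
Qed.

Lemma prod_divisors_pq p q : prime p -> prime q -> p != q ->
  \prod_(d <- [:: 1; p; q; p * q]%N) 'Phi_d = 'X^(p * q) - 1.
Proof.
move=> pp qp ne_pq; have p0 := prime_gt0 pp; have q0 := prime_gt0 qp.
rewrite -prod_Cyclotomic ?muln_gt0 ?p0 //; apply: perm_big.
apply: uniq_perm (divisors_uniq _) _ => [|d].
  have p1 := prime_gt1 pp; have q1 := prime_gt1 qp.
  have lt_p : (p < p * q)%N by rewrite -[X in (X < _)%N]muln1 ltn_pmul2l.
  have lt_q : (q < p * q)%N by rewrite -[X in (X < _)%N]mul1n ltn_pmul2r.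
  by rewrite /= !inE !negb_or ne_pq; lia.
rewrite -dvdn_divisors ?muln_gt0 ?p0 // !inE.
apply/or4P/idP => [[]/eqP->|dvd_d].
- exact: dvd1n.
- exact: dvdn_mulr.
- exact: dvdn_mull.
- exact: dvdnn.
have [_ dvd_p] := primeP pp; have [_ dvd_q] := primeP qp.
have [co_dp|] := boolP (coprime d p).
  move: dvd_d; rewrite Gauss_dvdr // => /dvd_q/pred2P[]->; rewrite eqxx.
    by constructor 1.
  by constructor 3.
rewrite coprime_sym prime_coprime // negbK => /dvdnP[e dE].
move: dvd_d; rewrite {}dE mulnC dvdn_pmul2l // => /dvd_q/pred2P[]->.
  by constructor 2; rewrite muln1.
by constructor 4.
Qed.

Lemma Cyclotomic1_prime p : prime p -> 'Phi_1 * 'Phi_p = 'X^p - 1.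
Proof.
by move=> pp; rewrite Cyclotomic1 Cyclotomic_prime // -['X]expr1 XnsubM_geom muln1.
Qed.

Lemma Cyclotomic_prime_pq {p q} : prime p -> prime q -> p != q ->
  'Phi_p * 'Phi_(p * q) = geom p q.
Proof.
move=> pp qp ne_pq; have nz : 'X^q - 1 != 0 :> {poly int}.
  exact/monic_neq0/monicXnsubC/prime_gt0.
apply: (mulfI nz); rewrite XnsubM_geom -prod_divisors_pq //.
by rewrite !big_cons big_nil -Cyclotomic1_prime //; ring.
Qed.

Lemma Cyclotomic_prime_prime_pq {p q} : prime p -> prime q -> p != q ->
  'Phi_p * ('Phi_q * 'Phi_(p * q)) = geom (p * q) 1.
Proof.
move=> pp qp ne_pq; have nz : 'X^1 - 1 != 0 :> {poly int}.
  by apply/monic_neq0/monicXnsubC.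
apply: (mulfI nz); rewrite XnsubM_geom muln1 -prod_divisors_pq //.
by rewrite !big_cons big_nil Cyclotomic1 mulr1 expr1.
Qed.

Lemma coef_Cyclotomic_pq p q n : prime p -> prime q -> p != q ->
  ('Phi_(p * q))`_n = shift_semigroup p q 0 n - shift_semigroup p q 1 n.
Proof.
move=> pp qp ne_pq; apply: coef_Cyclotomic_pq_semigroup (prime_gt0 pp) _.
  by rewrite prime_coprime // dvdn_prime2.
by rewrite -Cyclotomic1_prime // -Cyclotomic_prime_pq // Cyclotomic1; ring.
Qed.

Lemma shift_semigroup01 p q k n : 0 <= shift_semigroup p q k n <= 1.
Proof. by rewrite /shift_semigroup; case: ((k <= n)%N && _). Qed.

Lemma shift_semigroupS p q k n :
  shift_semigroup p q k.+1 n.+1 = shift_semigroup p q k n.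
Proof. by rewrite /shift_semigroup ltnS subSS. Qed.

Lemma coef_X1sub_Cyclotomic_pq p q n : prime p -> prime q -> p != q ->
  (('X - 1) * 'Phi_(p * q))`_n =
    shift_semigroup p q 1 n *+ 2 - shift_semigroup p q 0 n
      - shift_semigroup p q 2 n.
Proof.
move=> pp qp ne_pq; rewrite -['X]expr1 coef_XnsubM !coef_Cyclotomic_pq //.
case: n => [|n]; first by rewrite /shift_semigroup /=; lra.
by rewrite subn1 /= !shift_semigroupS; lra.
Qed.

Lemma in_semigroup_dvd p q n : (0 < p)%N -> (p %| n)%N -> in_semigroup p q n.
Proof.
move=> p0 pn; apply/existsP; exists (Ordinal p0); rewrite mul0n leq0n /=.
by rewrite mod0n eq_sym.
Qed.

Lemma in_semigroup_small p q n : (0 < n < p)%N -> (p <= q)%N ->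
  in_semigroup p q n = false.
Proof.
move=> /andP[n0 np] pq; apply/negbTE/existsP => -[j /andP[le_jn]].
have -> : j = 0%N :> nat by nia.
by rewrite mul0n mod0n eq_sym => /(dvdn_leq n0); rewrite leqNgt np.
Qed.

Lemma in_semigroup_last_class p q n : coprime p q -> (0 < p)%N ->
  n = p.-1 * q %[mod p] -> in_semigroup p q n = (p.-1 * q <= n)%N.
Proof. by move=> co_pq p0 E; apply: in_semigroupE => //; rewrite prednK. Qed.

(* [p.-1 * q - p] is the Frobenius number of [p] and [q]. *)
Lemma in_semigroup_frobenius p q : coprime p q -> (1 < p < q)%N ->
  in_semigroup p q (p.-1 * q - p) = false.
Proof.
move=> co_pq /andP[p1 pq]; have le_p : (p <= p.-1 * q)%N by nia.
by rewrite in_semigroup_last_class //; [nia|nia|rewrite -[in RHS](subnK le_p) modnDr].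
Qed.

Lemma in_semigroup_near_frobenius p q n : coprime p q -> (1 < p < q)%N ->
  n = (p.-1 * q - p).-1 \/ n = (p.-1 * q - p).+1 -> in_semigroup p q n.
Proof.
move=> co_pq /andP[p1 pq] nE; have [j jp jn] := semigroup_class n co_pq (ltnW p1).
have F_gt0 : (p < p.-1 * q)%N by nia.
have qE : p.-1 * q = (p.-2 * q + q)%N by rewrite addnC -mulSn; congr (_ * _)%N; lia.
have le_n : (p.-2 * q <= n)%N by case: nE; lia.
rewrite (in_semigroupE co_pq jp jn) (leq_trans _ le_n) // leq_mul2r.
suff : j != p.-1 by lia.
apply: contraTneq p1 => jE; rewrite -leqNgt dvdn_leq //.
move: jn F_gt0 nE; rewrite {}jE; move: (p.-1 * q)%N => m.
move=> /eqP mn F_gt0 nE; have le_nm : (n <= m)%N by lia.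
move: mn; rewrite eqn_mod_dvd //; case: nE => nE.
  by rewrite (_ : m - n = p + 1)%N ?dvdn_addr //; lia.
by rewrite (_ : m - n = p.-1)%N ?gtnNdvd //; lia.
Qed.

Lemma size_X1sub_Cyclotomic_pq {p q} : prime p -> prime q -> p != q ->
  size (('X - 1) * 'Phi_(p * q)) = (p.-1 * q.-1).+2.
Proof.
move=> pp qp ne_pq; have co_pq : coprime p q by rewrite prime_coprime // dvdn_prime2.
rewrite size_Mmonic ?Cyclotomic_monic ?polyXsubC_eq0 //.
by rewrite size_XsubC size_Cyclotomic totient_coprime // !totient_prime.
Qed.

Lemma zero_one_Cyclotomic_prime p : prime p -> zero_one 'Phi_p.
Proof. by move=> pp; rewrite Cyclotomic_prime //; apply: geom_zero_one. Qed.

Lemma zero_one1 : zero_one 1.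
Proof. by move=> i; rewrite coef1; case: eqP. Qed.

Lemma Cyclotomic_pq_flat p q : prime p -> prime q -> p != q ->
  flat 'Phi_(p * q).
Proof.
move=> pp qp ne_pq; apply: flatP => i; rewrite coef_Cyclotomic_pq //.
by move: (shift_semigroup01 p q 0 i) (shift_semigroup01 p q 1 i); lra.
Qed.

Lemma divisor_flat p q (f : {poly int}) : prime p -> prime q -> p != q ->
  f \is monic -> divides f ('X^(p * q) - 1) ->
  f <> ('X - 1) * 'Phi_(p * q) -> f <> 'Phi_p * 'Phi_q -> flat f.
Proof.
move=> pp qp ne_pq fmon [h fh].
have p0 := prime_gt0 pp; have q0 := prime_gt0 qp.
have ne_qp : q != p by rewrite eq_sym.
have [||m] := @monic_divisor_prod_Cyclotomic [:: 1; p; q; p * q]%N f h _ fmon.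
- by rewrite /= p0 q0 muln_gt0 p0 q0.
- by rewrite prod_divisors_pq.
have X1 : 'Phi_1 = 'X^1 - 1 by rewrite expr1 Cyclotomic1.
have E1 k : 'X^k - 1 = ('X^k - 1) * 1 :> {poly int} by rewrite mulr1.
have Epq := Cyclotomic_prime_pq pp qp ne_pq.
have Eqp : 'Phi_q * 'Phi_(p * q) = geom q p.
  by rewrite mulnC Cyclotomic_prime_pq.
have Eall := Cyclotomic_prime_prime_pq pp qp ne_pq.
case: m => [|a [|b [|c [|d []]]]] // _ ->.
case: a b c d => [] [] [] [] /=; rewrite ?big_cons big_nil ?mulr1 => ne1 ne2.
- by rewrite Eall X1; apply/flat_XnsubM/geom_zero_one.
- rewrite mulrA Cyclotomic1_prime //.
  exact/flat_XnsubM/zero_one_Cyclotomic_prime.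
- by rewrite Epq X1; apply/flat_XnsubM/geom_zero_one.
- by rewrite Cyclotomic1_prime // E1; apply/flat_XnsubM/zero_one1.
- by rewrite Eqp X1; apply/flat_XnsubM/geom_zero_one.
- by rewrite Cyclotomic1_prime // E1; apply/flat_XnsubM/zero_one1.
- by rewrite Cyclotomic1 in ne1.
- by rewrite X1 E1; apply/flat_XnsubM/zero_one1.
- by rewrite Eall; apply/zero_one_flat/geom_zero_one.
- by [].
- by rewrite Epq; apply/zero_one_flat/geom_zero_one.
- exact/zero_one_flat/zero_one_Cyclotomic_prime.
- by rewrite Eqp; apply/zero_one_flat/geom_zero_one.
- exact/zero_one_flat/zero_one_Cyclotomic_prime.
- exact: Cyclotomic_pq_flat.
- exact/zero_one_flat/zero_one1.
Qed.

Lemma coefset_X1sub_Cyclotomic_pq_le2 {p q} : prime p -> prime q -> p != q ->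
  {subset coefset (('X - 1) * 'Phi_(p * q)) <= `[-2 : int, 2]}.
Proof.
move=> pp qp ne_pq x /coefsetP[i _ <-].
rewrite coef_X1sub_Cyclotomic_pq // itv_boundlr /= !bnd_simp.
move: (shift_semigroup01 p q 0 i) (shift_semigroup01 p q 1 i).
by move: (shift_semigroup01 p q 2 i); lra.
Qed.

Lemma coefset_X1sub_Cyclotomic_pq_mem {p q} : prime p -> prime q -> (p < q)%N ->
  {subset [:: -2; -1; 1; 2] <= coefset (('X - 1) * 'Phi_(p * q))}.
Proof.
move=> pp qp lt_pq; have ne_pq : p != q by rewrite ltn_eqF.
have p1 := prime_gt1 pp; have p0 := ltnW p1.
have co_pq : coprime p q by rewrite prime_coprime // dvdn_prime2.
have ltp1q : (1 < p < q)%N by rewrite p1.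
have szE := size_X1sub_Cyclotomic_pq pp qp ne_pq.
have in0 : in_semigroup p q 0 by apply: in_semigroup_dvd.
have in1 : in_semigroup p q 1 = false by rewrite in_semigroup_small ?p1 // ltnW.
move=> x; rewrite !inE => /or4P[] /eqP->; apply/coefsetP; rewrite szE.
- have F0 : (p < p.-1 * q)%N by nia.
  have FE : p.-1 * q = (p.-1 * q.-1 + p.-1)%N by nia.
  exists (p.-1 * q - p).+1; first lia.
  rewrite coef_X1sub_Cyclotomic_pq // /shift_semigroup subn0 !subSS subn0.
  rewrite in_semigroup_frobenius // andbF.
  rewrite !in_semigroup_near_frobenius ?subn1; try tauto.
  by rewrite !leq0n !ltnS subn_gt0 F0.
- exists 0%N => //; rewrite coef_X1sub_Cyclotomic_pq // /shift_semigroup /=.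
  by rewrite in0.
- exists (p.-1 * q.-1).+1 => //; rewrite -[_.+1]/(_.+2.-1) -szE -lead_coefE.
  apply/eqP; rewrite -monicE monicMl ?Cyclotomic_monic //.
  by rewrite -polyC1 monicXsubC.
- exists 1%N => //; rewrite coef_X1sub_Cyclotomic_pq // /shift_semigroup /=.
  by rewrite in0 in1.
Qed.

Lemma coefset_X1sub_Cyclotomic_pq_0 p q : prime p -> prime q -> (p < q)%N ->
  (3 < p)%N -> 0 \in coefset (('X - 1) * 'Phi_(p * q)).
Proof.
move=> pp qp lt_pq p3; have ne_pq : p != q by rewrite ltn_eqF.
apply/coefsetP; rewrite size_X1sub_Cyclotomic_pq //; exists 3%N; first by nia.
rewrite coef_X1sub_Cyclotomic_pq // /shift_semigroup.
by rewrite !in_semigroup_small ?(ltnW lt_pq) //; lia.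
Qed.

(* Among [n - 2, n - 1, n] there are [p] consecutive integers, all below
   [(p - 1) q]: one is divisible by [p], hence in the semigroup, and one is
   congruent to [(p - 1) q], hence outside it. *)
Lemma coefset_X1sub_Cyclotomic_pq_neq0 p q : prime p -> prime q -> (p < q)%N ->
  (p <= 3)%N -> 0 \notin coefset (('X - 1) * 'Phi_(p * q)).
Proof.
move=> pp qp lt_pq p3; have ne_pq : p != q by rewrite ltn_eqF.
have p1 := prime_gt1 pp; have p0 := ltnW p1.
have co_pq : coprime p q by rewrite prime_coprime // dvdn_prime2.
apply/coefsetP; rewrite size_X1sub_Cyclotomic_pq // => -[n lt_n].
rewrite coef_X1sub_Cyclotomic_pq // => eq0.
have [k k3 sk] : exists2 k, (k < 3)%N & shift_semigroup p q k n = 1.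
  suff [k k3 /andP[kn pk]] : exists2 k, (k < 3)%N & (k <= n)%N && (p %| n - k)%N.
    by exists k => //; rewrite /shift_semigroup kn in_semigroup_dvd.
  have [n2|n2] := ltnP n 2.
    by exists n; rewrite ?leqnn ?subnn ?dvdn0 // ltnW.
  have [pE|pE] : p = 2%N \/ p = 3%N by lia.
    by exists (1 + (n - 1) %% 2)%N; rewrite ?pE; lia.
  by exists (n %% 3)%N; rewrite ?pE; lia.
have [l l3 sl] : exists2 l, (l < 3)%N & shift_semigroup p q l n = 0.
  have [n2|n2] := ltnP n 2.
    by exists 2%N => //; rewrite /shift_semigroup leqNgt n2.
  suff [l l3 /and3P[ln /eqP pl lt_l]] : exists2 l, (l < 3)%N &
      [&& l <= n, n - l == p.-1 * q %[mod p] & n - l < p.-1 * q]%N.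
    exists l => //; rewrite /shift_semigroup ln in_semigroup_last_class //.
    by rewrite leqNgt lt_l.
  have [pE|pE] : p = 2%N \/ p = 3%N by lia.
    exists (1 + (n - 1 + q) %% 2)%N; first by lia.
    by move: co_pq lt_n; rewrite pE coprime2n; lia.
  exists ((n + q) %% 3)%N; first by lia.
  by move: lt_n; rewrite ?pE; lia.
move: eq0 (shift_semigroup01 p q 0 n) (shift_semigroup01 p q 1 n).
move: (shift_semigroup01 p q 2 n) sk sl.
case: k k3 => [|[|[|]]] // _; case: l l3 => [|[|[|]]] // _; rewrite mulr2n;
by move: (shift_semigroup p q) => s; move: (s 0 n) (s 1 n) (s 2 n); lia.
Qed.

Lemma coef_geom1M p q n :
  (geom p 1 * geom q 1)`_n = (\sum_(i < p) ((i <= n) && (n - i < q)))%N%:Z.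
Proof.
rewrite mulr_suml coef_sum -natz natr_sum; apply: eq_bigr => i _.
by rewrite muln1 coefXnM coef_geom1 ltnNge; case: (i <= n)%N.
Qed.

Lemma coefset_geom1M p q : (0 < p <= q)%N ->
  coefset (geom p 1 * geom q 1) =i `[1 : int, p%:Z].
Proof.
move=> /andP[p0 le_pq] x; have q0 := leq_trans p0 le_pq.
have sz k : (0 < k)%N -> size (geom k 1) = k.
  move=> k0; have -> : geom k 1 = \poly_(i < k) 1.
    by apply/polyP => i; rewrite coef_geom1 coef_poly; case: ltnP.
  by rewrite size_poly_eq // oner_neq0.
have szM : size (geom p 1 * geom q 1) = (p + q).-1.
  by rewrite size_mul -?size_poly_gt0 ?sz.
rewrite itv_boundlr /= !bnd_simp; apply/coefsetP/andP => [[n lt_n <-]|].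
  rewrite coef_geom1M szM in lt_n *; split; rewrite lez_nat.
    have lt_i : (n - q.-1 < p)%N by lia.
    rewrite (bigD1 (Ordinal lt_i)) //= (_ : _ && _) //; lia.
  rewrite -[X in (_ <= X)%N]card_ord -sum1_card.
  by apply: leq_sum => i _; case: (_ && _).
case: x => k [k0 kp]; last by lia.
have {}k0 : (0 < k)%N by lia.
have {}kp : (k <= p)%N by lia.
exists k.-1; first by rewrite szM; lia.
rewrite coef_geom1M; congr Posz.
transitivity (\sum_(i < p | i < k) 1)%N.
  rewrite [RHS]big_mkcond /=; apply: eq_bigr => i _; case: (ltnP i k) => ik.
    by rewrite (_ : _ && _) //; lia.
  by rewrite leqNgt (_ : k.-1 < i)%N //; lia.
by rewrite -(big_ord_widen p (fun=> 1%N)) // sum1_card card_ord.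
Qed.

Theorem theorem2 (p q : nat) (p_prime : prime p) (q_prime : prime q)
    (lt_pq : (p < q)%N) :
  [/\ forall f : {poly int},
        f \is monic -> divides f ('X^(p * q)%N - 1) ->
        f <> ('X - 1) * 'Phi_(p * q)%N -> f <> 'Phi_p * 'Phi_q ->
        flat f,
      (p <= 3)%N ->
        coefset (('X - 1) * 'Phi_(p * q)%N) =i [:: -2; -1; 1; 2],
      (3 < p)%N ->
        coefset (('X - 1) * 'Phi_(p * q)%N) =i `[-2 : int, 2]
    & coefset ('Phi_p * 'Phi_q) =i `[1 : int, (minn p q)%:Z]].
Proof.
have ne_pq : p != q by rewrite ltn_eqF.
have memP := coefset_X1sub_Cyclotomic_pq_mem p_prime q_prime lt_pq.
have le2 := coefset_X1sub_Cyclotomic_pq_le2 p_prime q_prime ne_pq.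
split.
- by move=> f; apply: divisor_flat.
- move=> p3 x; apply/idP/idP => [xc|/memP//].
  have := le2 x xc; rewrite itv_boundlr /= !bnd_simp !inE => /andP[ge_x le_x].
  have : x != 0.
    apply: contraTneq xc => ->.
    exact: coefset_X1sub_Cyclotomic_pq_neq0.
  lia.
- move=> p3 x; apply/idP/idP => [/le2//|].
  rewrite itv_boundlr /= !bnd_simp => /andP[ge_x le_x].
  have [->|x0] := eqVneq x 0; first exact: coefset_X1sub_Cyclotomic_pq_0.
  by apply: memP; rewrite !inE; lia.
- rewrite !Cyclotomic_prime // (minn_idPl (ltnW lt_pq)).
  by apply: coefset_geom1M; rewrite prime_gt0 // ltnW.
Qed.
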